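(* Let $d,K\ge 1$, $\Theta=\{1,\dots,K\}$, and for each $\theta\in\Theta$ let $\mathcal D_\theta$ be a probability distribution of a pair $(r,\mathbf a)\in\mathbb R_+\times\mathbb R_+^d$. Assume there are constants $R_{\max},A_{\max}>0$ such that for every $\theta$, $0\le r\le R_{\max}$ and $\|\mathbf a\|_\infty\le A_{\max}$ almost surely under $\mathcal D_\theta$. Let $\mathbf b\in\mathbb R_+^d$ be the per-period budget, with smallest component $b_{\min}>0$; put $P_{\max}=2R_{\max}/b_{\min}$ and $\mathcal P=[0,P_{\max}]^d$. Then $$V^{\mathrm{mix}}(\mathbf b)=\max_{\mathbf w\in\Delta_K}\min_{\mathbf p\in\mathcal P}\Big\{\langle\mathbf p,\mathbf b\rangle+\sum_{\theta\in\Theta}w_\theta g_\theta(\mathbf p)\Big\}=\min_{\mathbf p\in\mathcal P}\Big\{\langle\mathbf p,\mathbf b\rangle+\max_{\theta\in\Theta}g_\theta(\mathbf p)\Big\}.$$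
   Context: $\mathbb E_\theta$ denotes expectation under $(r,\mathbf a)\sim\mathcal D_\theta$. $\Delta_K=\{\mathbf w\in\mathbb R_+^K:\sum_\theta w_\theta=1\}$. The surplus function is $g_\theta(\mathbf p):=\mathbb E_\theta[(r-\langle\mathbf p,\mathbf a\rangle)_+]$, where $(x)_+=\max\{x,0\}$. The mixed fluid value is $$V^{\mathrm{mix}}(\mathbf b):=\max_{\mathbf w\in\Delta_K}\ \max_{\{x_\theta\}}\Big\{\sum_{\theta}w_\theta\,\mathbb E_\theta[r\,x_\theta(r,\mathbf a)]\ :\ \sum_\theta w_\theta\,\mathbb E_\theta[\mathbf a\,x_\theta(r,\mathbf a)]\le\mathbf b\Big\},$$ where the inner maximum is over families of measurable acceptance rules $x_\theta:\mathbb R_+\times\mathbb R_+^d\to[0,1]$, $\theta\in\Theta$, and vector inequalities are componentwise. (In the online problem with horizon $T$ and total budget $\mathbf B$, the budget satisfies $\mathbf B=T\mathbf b$.) *)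

(* Defs.v *)
From HB Require Import structures.
From mathcomp Require Import all_boot all_order all_algebra.
From mathcomp Require Import all_classical all_reals all_analysis.

Import Order.TTheory GRing.Theory Num.Theory.
Import numFieldNormedType.Exports.

Local Open Scope classical_set_scope.
Local Open Scope ring_scope.

(* [max_on D f] and [min_on D f] are the values written max and min in the
   mathematics only when the extremum is attained; [attains_max D f] and
   [attains_min D f] assert that it is. *)
Definition max_on {R : realType} {T : Type} (D : set T) (f : T -> R) : R :=
  sup [set f x | x in D].

Definition min_on {R : realType} {T : Type} (D : set T) (f : T -> R) : R :=
  inf [set f x | x in D].

Definition attains_max {R : realType} {T : Type} (D : set T) (f : T -> R) :
    Prop :=
  exists2 x, D x & forall y, D y -> f y <= f x.

Definition attains_min {R : realType} {T : Type} (D : set T) (f : T -> R) :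
    Prop :=
  exists2 x, D x & forall y, D y -> f x <= f y.

(* Pairs (r, a), with the product Borel sigma-algebra; prices, budgets and
   mixture weights are row vectors instead. Nonnegativity of r and a is imposed
   on the distributions, not on the type. *)
Definition sample (R : realType) (d : nat) :=
  (measurableTypeR R * d.-tuple (measurableTypeR R))%type.

Definition reward {R : realType} {d : nat} (z : sample R d) : R := z.1.

Definition usage {R : realType} {d : nat} (z : sample R d) (j : 'I_d) : R :=
  tnth z.2 j.

(* All random variables below are almost surely bounded, so [fine] discards no
   infinite value. *)
Definition Ex {R : realType} {d : nat} (P : probability (sample R d) R)
    (X : sample R d -> R) : R :=
  fine ('E_P[X])%E.

Definition dot {R : realType} {d : nat} (u v : 'rV[R]_d) : R :=
  \sum_(j < d) u 0 j * v 0 j.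

Definition cost {R : realType} {d : nat} (p : 'rV[R]_d) (z : sample R d) : R :=
  \sum_(j < d) p 0 j * usage z j.

Definition surplus {R : realType} {d : nat} (P : probability (sample R d) R)
    (p : 'rV[R]_d) : R :=
  Ex P (fun z => Num.max (reward z - cost p z) 0).

Definition simplex {R : realType} (K : nat) : set 'rV[R]_K :=
  [set w | (forall t, 0 <= w 0 t) /\ \sum_(t < K) w 0 t = 1].

(* Acceptance rules are total on R x R^d: a measurable rule on the nonnegative
   orthant extends by 0, and its values off the orthant are irrelevant since
   the distributions give the complement measure 0. *)
Definition acceptance_rule {R : realType} {d : nat} (x : sample R d -> R) :
    Prop :=
  measurable_fun [set: sample R d] x /\ forall z, 0 <= x z <= 1.

Definition mixed_reward {R : realType} {d K : nat}
    (D : 'I_K -> probability (sample R d) R) (w : 'rV[R]_K)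
    (x : 'I_K -> sample R d -> R) : R :=
  \sum_(t < K) w 0 t * Ex (D t) (fun z => reward z * x t z).

Definition feasible {R : realType} {d K : nat}
    (D : 'I_K -> probability (sample R d) R) (b : 'rV[R]_d) (w : 'rV[R]_K) :
    set ('I_K -> sample R d -> R) :=
  [set x | (forall t, acceptance_rule (x t)) /\
    forall j : 'I_d,
      \sum_(t < K) w 0 t * Ex (D t) (fun z => usage z j * x t z) <= b 0 j].

Definition Vmix {R : realType} {d K : nat}
    (D : 'I_K -> probability (sample R d) R) (b : 'rV[R]_d) : R :=
  max_on (simplex K) (fun w => max_on (feasible D b w) (mixed_reward D w)).

Definition bmin {R : realType} {d : nat} (b : 'rV[R]_d) : R :=
  min_on [set: 'I_d] (fun j => b 0 j).

Definition price_box {R : realType} (d : nat) (Pmax : R) : set 'rV[R]_d :=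
  [set p | forall j, 0 <= p 0 j <= Pmax].

Definition mixed_dual {R : realType} {d K : nat}
    (D : 'I_K -> probability (sample R d) R) (b : 'rV[R]_d) (w : 'rV[R]_K)
    (p : 'rV[R]_d) : R :=
  dot p b + \sum_(t < K) w 0 t * surplus (D t) p.

Definition robust_dual {R : realType} {d K : nat}
    (D : 'I_K -> probability (sample R d) R) (b : 'rV[R]_d) (p : 'rV[R]_d) : R :=
  dot p b + max_on [set: 'I_K] (fun t => surplus (D t) p).

(* Main.v *)
(** Lagrangian duality for a linear program with infinitely many variables.
    Everything rests on a minimax theorem of Kneser type: if [f x p] is convex
    and continuous in [p] on a compact convex set and concave-like in [x], and if
    every [p] has an [x] with [f x p > c], then a single [x] works for all [p].
    Compactness gives finitely many [x]'s, and these are merged two at a time.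

    Applied to the Lagrangian of the fluid problem at fixed [w], it gives rules
    whose Lagrangian is almost the dual value at every price of the box; as the
    box is large enough, scaling them down makes them feasible without losing
    reward. Applied to the bilinear dependence on [w], it exchanges the maximum
    over the simplex with the minimum over the box.

    An optimal rule exists because the nearly optimal feasible rules form a
    decreasing sequence of convex sets that are stable under L^1 limits, and
    elements of nearly minimal L^2 norm in them form a Cauchy sequence. *)
Require Import Defs.
From HB Require Import structures.
From mathcomp Require Import all_boot all_order all_algebra.
From mathcomp Require Import all_classical all_reals all_analysis.
From mathcomp Require Import measurable_realfun.
From mathcomp Require Import ring lra.

Set Implicit Arguments.
Unset Strict Implicit.
Unset Printing Implicit Defensive.

Import Order.TTheory GRing.Theory Num.Theory.
Import numFieldNormedType.Exports.

Local Open Scope classical_set_scope.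
Local Open Scope ring_scope.

(** * Attained extrema, continuity, and compactness of the box and the simplex *)

(** Extrema are evaluated through an explicit optimizer, so the default value of [sup] on an empty
    or unbounded set never enters. *)
Lemma max_onE (R : realType) (T : Type) (A : set T) (f : T -> R) (x : T) :
  A x -> (forall y, A y -> f y <= f x) -> max_on A f = f x.
Proof.
move=> Ax fx; apply/eqP; rewrite eq_le; apply/andP; split.
  by apply: ge_sup; [exists (f x), x | move=> _ [y Ay <-]; exact: fx].
apply: ub_le_sup; last by exists x.
by exists (f x) => _ [y Ay <-]; exact: fx.
Qed.

Lemma min_onE (R : realType) (T : Type) (A : set T) (f : T -> R) (x : T) :
  A x -> (forall y, A y -> f x <= f y) -> min_on A f = f x.
Proof.
move=> Ax fx; apply/eqP; rewrite eq_le; apply/andP; split.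
  apply: ge_inf; last by exists x.
  by exists (f x) => _ [y Ay <-]; exact: fx.
by apply: lb_le_inf; [exists (f x), x | move=> _ [y Ay <-]; exact: fx].
Qed.

Lemma attains_max_le (R : realType) (T : Type) (A : set T) (f : T -> R) x :
  attains_max A f -> A x -> f x <= max_on A f.
Proof. by move=> [y Ay fy] Ax; rewrite (max_onE Ay)// fy. Qed.

Lemma attains_min_ge (R : realType) (T : Type) (A : set T) (f : T -> R) x :
  attains_min A f -> A x -> min_on A f <= f x.
Proof. by move=> [y Ay fy] Ax; rewrite (min_onE Ay)// fy. Qed.

Lemma attains_max_ord (R : realType) (n : nat) (f : 'I_n -> R) :
  (0 < n)%N -> attains_max [set: 'I_n] f.
Proof.
case: n f => // n f _.
have [i _ fi] := @arg_maxP _ _ _ ord0 predT f isT.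
by exists i => // j _; exact: fi.
Qed.

Lemma attains_min_ord (R : realType) (n : nat) (f : 'I_n -> R) :
  (0 < n)%N -> attains_min [set: 'I_n] f.
Proof.
case: n f => // n f _.
have [i _ fi] := @arg_minP _ _ _ ord0 predT f isT.
by exists i => // j _; exact: fi.
Qed.

Lemma compact_attains_max (R : realType) (T : topologicalType) (A : set T)
    (f : T -> R) :
  A !=set0 -> compact A -> continuous f -> attains_max A f.
Proof.
move=> A0 cA cf.
have [x] := compact_EVT_max A0 cA (continuous_subspaceT cf).
by rewrite inE => Ax fx; exists x => // y Ay; apply: fx; rewrite inE.
Qed.

Lemma compact_attains_min (R : realType) (T : topologicalType) (A : set T)
    (f : T -> R) :
  A !=set0 -> compact A -> continuous f -> attains_min A f.
Proof.
move=> A0 cA cf.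
have [x] := compact_EVT_min A0 cA (continuous_subspaceT cf).
by rewrite inE => Ax fx; exists x => // y Ay; apply: fx; rewrite inE.
Qed.

(** A one-sided bound suffices, since exchanging [x] and [y] gives the other side. *)
Lemma lipschitz_coord_continuous (R : realType) (n : nat) (f : 'rV[R]_n -> R)
    (C : R) :
  (forall x y, f x - f y <= C * \sum_(j < n) `|x 0 j - y 0 j|) ->
  continuous f.
Proof.
move=> fC x s /= /(nbhs_ballP (f x)) [e /= e0 es].
(* The added 1 keeps [c] positive when [C] or [n] vanishes and makes the final estimate strict. *)
pose c := `|C| * n%:R + 1.
have c0 : 0 < c by rewrite ltr_wpDl// mulr_ge0.
apply/nbhs_ballP; exists (e / c) => /=; first by rewrite divr_gt0.
move=> y [_ xy]; apply: es => /=.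
have {}xy j : `|x 0 j - y 0 j| <= e / c by exact/ltW/(xy 0 j).
have main : `|C| * \sum_(j < n) `|x 0 j - y 0 j| < e.
  apply: (@le_lt_trans _ _ (`|C| * (n%:R * (e / c)))).
    rewrite ler_wpM2l// (le_trans (ler_sum _ (fun j _ => xy j)))//.
    by rewrite sumr_const card_ord mulr_natl.
  by rewrite !mulrA ltr_pdivrMr// [ltLHS]mulrC ltr_pM2l// ltrDl.
have S0 : 0 <= \sum_(j < n) `|x 0 j - y 0 j| by apply: sumr_ge0.
have CS := le_lt_trans (ler_wpM2r S0 (ler_norm C)) main.
rewrite /ball /= ltr_norml (le_lt_trans (fC x y) CS) andbT.
rewrite ltrNl opprB (le_lt_trans (fC y x))//.
by under eq_bigr do rewrite distrC.
Qed.

Lemma price_box_compact (R : realType) (n : nat) (M : R) :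
  compact (price_box n M).
Proof.
have := @rV_compact R n (fun=> `[0, M]%classic) (fun=> @segment_compact R 0 M).
by congr compact; apply/seteqP; split=> p /= + j => /(_ j); rewrite in_itv.
Qed.

Lemma sum_le_norm (R : realType) (n : nat) (c : 'rV[R]_n) (u v : 'rV[R]_n)
    (M : R) :
  (forall j, `|c 0 j| <= M) ->
  \sum_(j < n) u 0 j * c 0 j - \sum_(j < n) v 0 j * c 0 j
    <= M * \sum_(j < n) `|u 0 j - v 0 j|.
Proof.
move=> cM; rewrite -sumrB mulr_sumr; apply: ler_sum => j _.
by rewrite -mulrBl (le_trans (ler_norm _))// normrM mulrC ler_wpM2r.
Qed.

Lemma dot_lipschitz (R : realType) (n : nat) (u v c : 'rV[R]_n) :
  dot u c - dot v c <=
  (\sum_(j < n) `|c 0 j|) * \sum_(j < n) `|u 0 j - v 0 j|.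
Proof. by apply: sum_le_norm => j; rewrite (bigD1 j)//= lerDl sumr_ge0. Qed.

Lemma dot_continuous (R : realType) (n : nat) (c : 'rV[R]_n) :
  continuous (fun u : 'rV[R]_n => dot u c).
Proof.
by apply: lipschitz_coord_continuous => u v; exact: dot_lipschitz.
Qed.

(** The simplex is the slice of the unit box by the closed condition that the coordinates sum to
    1. *)
Lemma simplex_compact (R : realType) (n : nat) : compact (@simplex R n).
Proof.
have -> : @simplex R n = price_box n 1 `&` [set w | dot w (const_mx 1) = 1].
  have dot1 (w : 'rV[R]_n) : dot w (const_mx 1) = \sum_(j < n) w 0 j.
    by apply: eq_bigr => j _; rewrite mxE mulr1.
  apply/seteqP; split=> w /= [w0 w1]; split; rewrite ?dot1// -?dot1// => j.
    by rewrite w0/= -w1 (bigD1 j)//= lerDl sumr_ge0.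
  by have /andP[] := w0 j.
apply: compact_closedI; first exact: price_box_compact.
apply: (@preimage_closed _ _ (fun w => dot w (const_mx 1)) [set 1]) => //.
  by move=> w _; exact: dot_continuous.
Qed.

Lemma simplex_delta (R : realType) (n : nat) (t : 'I_n) :
  simplex _ (delta_mx 0 t : 'rV[R]_n).
Proof.
split=> [i|]; first by rewrite mxE ler0n.
rewrite (bigD1 t)//= big1 ?mxE ?eqxx ?addr0// => i /negbTE it.
by rewrite mxE it.
Qed.

Lemma simplex_nonempty (R : realType) (n : nat) :
  (0 < n)%N -> @simplex R n !=set0.
Proof. by case: n => // n _; exists (delta_mx 0 0); exact: simplex_delta. Qed.

(** * A minimax theorem *)

Definition is_convex_set (R : numDomainType) (V : lmodType R) (A : set V) :
    Prop :=
  forall x y t, A x -> A y -> 0 <= t <= 1 -> A (t *: x + (1 - t) *: y).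

Definition is_convex_fun (R : numDomainType) (V : lmodType R) (f : V -> R) :
    Prop :=
  forall x y t, 0 <= t <= 1 ->
    f (t *: x + (1 - t) *: y) <= t * f x + (1 - t) * f y.

Lemma closed_sublevel (R : realType) (T : topologicalType) (f : T -> R)
    (c : R) :
  continuous f -> closed [set x | f x <= c].
Proof.
move=> cf; apply: (@preimage_closed _ _ f [set y | y <= c]).
  by move=> x _; exact: cf.
exact: closed_le.
Qed.

Lemma convex_sublevel (R : numDomainType) (V : lmodType R) (f : V -> R) :
  is_convex_fun f -> is_convex_set [set x | f x <= 0].
Proof.
move=> cf x y t /= fx fy t01; apply: le_trans (cf _ _ _ t01) _.
have /andP[t0 t1] := t01.
by rewrite -[leRHS]addr0 lerD// mulr_ge0_le0// subr_ge0.
Qed.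

(** The ratio of [- f] to [g] is continuous on the compact set where [f <= 0], so it has a maximizer
    there. If that set is empty, [rho] is 0, hence the alternative in the conclusion. *)
Lemma max_ratio (R : realType) (T : topologicalType) (A : set T)
    (f g : T -> R) :
  compact A -> continuous f -> continuous g ->
  (forall x, A x -> f x <= 0 -> 0 < g x) ->
  exists2 rho, 0 <= rho /\ forall x, A x -> f x <= 0 -> - f x <= rho * g x &
    rho = 0 \/ exists2 x, A x & 0 < g x /\ - f x = rho * g x.
Proof.
move=> cA cf cg fg; pose B := A `&` [set x | f x <= 0].
have [B0|/nonemptyPn B0] := pselect (B !=set0); last first.
  exists 0; last by left.
  split=> // x Ax fx; have : B x by [].
  by rewrite B0.
have cB : compact B by apply: compact_closedI => //; exact: closed_sublevel.
have cq : {within B, continuous (fun x => - f x / g x)}.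
  apply: continuous_in_subspaceT => x; rewrite inE => -[Ax fx].
  apply: cvgM; first by apply: cvgN; exact: cf.
  by apply: cvgV; [rewrite gt_eqF// fg | exact: cg].
have [x] := compact_EVT_max B0 cB cq; rewrite inE => -[Ax fx] xmax.
have gx := fg x Ax fx.
exists (- f x / g x); last first.
  by right; exists x => //; split=> //; rewrite divfK// gt_eqF.
split=> [|y Ay fy]; first by rewrite divr_ge0 ?oppr_ge0// ltW.
rewrite -ler_pdivrMr; last exact: fg.
by apply: xmax; rewrite inE.
Qed.

(* If rho and sigma are the maximal ratios of [- f] to [g] where [f <= 0] and of
   [- g] to [f] where [g <= 0], then rho * sigma < 1: otherwise [f] and [g] are
   both nonpositive at some point of the segment joining the two maximizers. *)
Lemma positive_combination (R : realType) (n : nat) (A : set 'rV[R]_n)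
    (f g : 'rV[R]_n -> R) :
  compact A -> is_convex_set A -> continuous f -> continuous g ->
  is_convex_fun f -> is_convex_fun g ->
  (forall x, A x -> f x <= 0 -> 0 < g x) ->
  exists2 t, 0 <= t <= 1 & forall x, A x -> 0 < t * f x + (1 - t) * g x.
Proof.
move=> cA vA cf cg vf vg fg.
have gf x : A x -> g x <= 0 -> 0 < f x.
  by move=> Ax gx; rewrite ltNge; apply/negP => /(fg _ Ax); rewrite ltNge gx.
have [rho [rho0 rhoP] rho_max] := max_ratio cA cf cg fg.
have [sig [sig0 sigP] sig_max] := max_ratio cA cg cf gf.
have rs : rho * sig < 1.
  case: rho_max => [->|[x Ax [gx fx]]]; first by rewrite mul0r.
  case: sig_max => [->|[y Ay [fy gy]]]; first by rewrite mulr0.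
  rewrite ltNge; apply/negP => rs1.
  have q0 : 0 < g x + sig * f y by rewrite ltr_pwDl// mulr_ge0// ltW.
  (* This weight makes the chord [t * g x + (1 - t) * g y] vanish. The chord of [f] is then
     [1 - rho * sig] times a nonnegative number, hence nonpositive. *)
  pose t := sig * f y / (g x + sig * f y).
  have t01 : 0 <= t <= 1.
    rewrite /t; apply/andP; split; last first.
      by rewrite ler_pdivrMr// mul1r lerDr ltW.
    by rewrite divr_ge0 ?mulr_ge0 ?(ltW q0) ?(ltW fy).
  have t1 : 1 - t = g x / (g x + sig * f y).
    by rewrite /t; field; rewrite gt_eqF.
  have Az := vA x y t Ax Ay t01.
  have fz := vf x y t t01; have gz := vg x y t t01.
  have gx' : g y = - (sig * f y) by rewrite -gy opprK.
  have fx' : f x = - (rho * g x) by rewrite -fx opprK.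
  have fz0 : f (t *: x + (1 - t) *: y) <= 0.
    apply: le_trans fz _; rewrite t1 fx' /t.
    have -> : sig * f y / (g x + sig * f y) * - (rho * g x) +
        g x / (g x + sig * f y) * f y =
        (1 - rho * sig) * (g x * f y / (g x + sig * f y)).
      by field; rewrite gt_eqF.
    rewrite mulr_le0_ge0 ?subr_le0//.
    by rewrite divr_ge0 ?mulr_ge0 ?(ltW q0) ?(ltW fy) ?(ltW gx).
  have := fg _ Az fz0; apply/negP; rewrite -leNgt.
  apply: le_trans gz _; rewrite t1 gx' /t le_eqVlt; apply/orP; left; apply/eqP.
  by field; rewrite gt_eqF.
have rs2 : 0 < (1 + sig) + (1 + rho) by rewrite addr_gt0// ltr_pwDl.
(* Up to normalization the combination is [(1 + sig) * f + (1 + rho) * g]. It is at least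
   [(1 - rho * sig) * g] where [f <= 0], and at least [(1 - rho * sig) * f] where [g <= 0]. *)
exists ((1 + sig) / ((1 + sig) + (1 + rho))).
  rewrite divr_ge0 ?addr_ge0//= ler_pdivrMr// mul1r lerDl addr_ge0//.
move=> x Ax.
have -> : (1 + sig) / (1 + sig + (1 + rho)) * f x +
    (1 - (1 + sig) / (1 + sig + (1 + rho))) * g x =
    ((1 + sig) * f x + (1 + rho) * g x) / (1 + sig + (1 + rho)).
  by field; rewrite gt_eqF.
apply: divr_gt0 => //.
have [fx|fx] := leP (f x) 0.
  by have gx := fg x Ax fx; have := rhoP x Ax fx; nra.
have [gx|gx] := leP (g x) 0; last by nra.
by have := sigP x Ax gx; nra.
Qed.

(** Concavity in the sense of Ky Fan: no linear structure on [X] is required, so [X] may be a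
    subtype of weights or of rules. *)
Definition concave_like (R : numDomainType) (X T : Type) (f : X -> T -> R) :=
  forall x y t, 0 <= t <= 1 ->
    exists z, forall p, t * f x p + (1 - t) * f y p <= f z p.

(** Induction on the list, for all [A] at once. Where [f x <= 0] the tail of the list suffices and
    yields one [y]; a positive combination of [f x] and [f y] is then dominated by a single [f z].
    An empty list forces [A] to be empty. *)
Lemma finite_minimax (R : realType) (n : nat) (X : Type) (A : set 'rV[R]_n)
    (f : X -> 'rV[R]_n -> R) (x0 : X) (s : seq X) :
  compact A -> is_convex_set A -> (forall x, continuous (f x)) ->
  (forall x, is_convex_fun (f x)) -> concave_like f ->
  (forall p, A p -> exists2 x, List.In x s & 0 < f x p) ->
  exists x, forall p, A p -> 0 < f x p.
Proof.
move=> + + cf vf ccf.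
elim: s A => [|x s IH] A cA vA sP.
  by exists x0 => p /sP[].
have [y yP] : exists y, forall p, A p /\ f x p <= 0 -> 0 < f y p.
  apply: (IH (A `&` [set p | f x p <= 0])).
  - by apply: compact_closedI => //; exact: closed_sublevel.
  - move=> p q t [Ap fp] [Aq fq] t01; split; first exact: vA.
    exact: (convex_sublevel (vf x)).
  - move=> p [Ap /= fp]; have [z [<-|sz] fz] := sP p Ap; last by exists z.
    by move: fz; rewrite ltNge fp.
have [//|t t01 tP] := @positive_combination R n A (f x) (f y) cA vA
  (cf x) (cf y) (vf x) (vf y).
  by move=> p Ap fp; exact: yP.
have [z zP] := ccf x y t t01.
by exists z => p Ap; exact: lt_le_trans (tP p Ap) (zP p).
Qed.

(** Strictness makes the sets where [f x] exceeds [c] open, so finitely many of them cover [A].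
    Subtracting [c] reduces to the threshold 0. *)
Lemma minimax (R : realType) (n : nat) (X : Type) (A : set 'rV[R]_n)
    (f : X -> 'rV[R]_n -> R) (x0 : X) (c : R) :
  compact A -> is_convex_set A -> (forall x, continuous (f x)) ->
  (forall x, is_convex_fun (f x)) -> concave_like f ->
  (forall p, A p -> exists x, c < f x p) ->
  exists x, forall p, A p -> c < f x p.
Proof.
move=> cA vA cf vf ccf fP.
pose g x p := f x p - c.
have cg x : continuous (g x).
  by move=> p; exact: (@cvgB _ R^o _ _ _ _ _ _ _ (cf x p) (cvg_cst c)).
have gE x p : (0 < g x p) = (c < f x p) by rewrite subr_gt0.
suff [x xP] : exists x, forall p, A p -> 0 < g x p.
  by exists x => p Ap; rewrite -gE xP.
have [s sP] : exists s : seq X,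
    forall p, A p -> exists2 x, List.In x s & 0 < g x p.
  have /choice[h hP] : forall p, exists x, A p -> 0 < g x p.
    move=> p; have [Ap|nAp] := pselect (A p); last by exists x0.
    by have [x fx] := fP p Ap; exists x; rewrite gE.
  have := cA; rewrite compact_cover => cover_A.
  have [||F _ AF] := cover_A _ A (fun p => [set q | 0 < g (h p) q]).
  - move=> p _; apply: (@open_comp _ _ (g (h p)) [set y | 0 < y]).
      by move=> q _; exact: cg.
    exact: open_gt.
  - by move=> p Ap; exists p => //; exact: hP.
  exists (map h (finmap.enum_fset F)) => p /AF[q /= qF gq]; exists (h q) => //.
  have {qF} : q \in finmap.enum_fset F by [].
  elim: (finmap.enum_fset F) => //= a l IH.
  rewrite inE => /orP[/eqP->|/IH]; first by left.
  by right.
apply: (@finite_minimax _ _ _ _ _ x0 s) => //.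
- move=> x p q t t01; rewrite /g; have := vf x p q t t01; lra.
- move=> x y t t01; have [z zP] := ccf x y t t01; exists z => p.
  by rewrite /g; have := zP p; lra.
Qed.

(** * Expectations of almost surely bounded variables *)

Lemma integrable_ae_le (R : realType) (d : measure_display)
    (T : measurableType d) (P : probability T R) (X : T -> R) (M : R) :
  measurable_fun [set: T] X -> {ae P, forall z, `|X z| <= M} ->
  P.-integrable [set: T] (EFin \o X).
Proof.
move=> mX XM; apply/integrableP; split; first exact: measurableT_comp.
apply: (@le_lt_trans _ _ (\int[P]_(z in [set: T]) (cst `|M|%:E) z)%E).
  apply: ae_ge0_le_integral => //.
  - by do 2 apply: measurableT_comp => //.
  - by move=> z _; rewrite lee_fin.
  - by apply: filterS XM => z Xz _; rewrite lee_fin (le_trans Xz)// ler_norm.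
by rewrite integral_cst//= probability_setT mule1 ltry.
Qed.

(** A class stable under the operations used below and contained in the integrable functions, so
    that linearity of [Ex] applies throughout. *)
Definition ae_bounded (R : realType) (d : nat)
    (P : probability (sample R d) R) (X : sample R d -> R) : Prop :=
  measurable_fun [set: sample R d] X /\ exists M, {ae P, forall z, `|X z| <= M}.

Section expectation.
Context {R : realType} {d : nat}.
Variable P : probability (sample R d) R.
Implicit Types X Y : sample R d -> R.

Lemma ae_bounded_cst c : ae_bounded P (fun=> c).
Proof. by split=> //; exists `|c|; apply: aeW. Qed.

Lemma ae_boundedD X Y : ae_bounded P X -> ae_bounded P Y ->
  ae_bounded P (fun z => X z + Y z).
Proof.
move=> [mX [M XM]] [mY [N YN]]; split; first exact: measurable_funD.
exists (M + N); apply: filterS2 XM YN => z Xz Yz.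
by rewrite (le_trans (ler_normD _ _))// lerD.
Qed.

Lemma ae_boundedM X Y : ae_bounded P X -> ae_bounded P Y ->
  ae_bounded P (fun z => X z * Y z).
Proof.
move=> [mX [M XM]] [mY [N YN]]; split; first exact: measurable_funM.
exists (M * N); apply: filterS2 XM YN => z Xz Yz.
by rewrite normrM ler_pM.
Qed.

Lemma ae_boundedN X : ae_bounded P X -> ae_bounded P (fun z => - X z).
Proof.
move=> [mX [M XM]]; split; first exact: measurableT_comp.
by exists M; apply: filterS XM => z; rewrite normrN.
Qed.

Lemma ae_boundedB X Y : ae_bounded P X -> ae_bounded P Y ->
  ae_bounded P (fun z => X z - Y z).
Proof. by move=> bX bY; apply: ae_boundedD => //; exact: ae_boundedN. Qed.

Lemma ae_bounded_norm X : ae_bounded P X -> ae_bounded P (fun z => `|X z|).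
Proof.
move=> [mX [M XM]]; split; first exact: measurableT_comp.
by exists M; apply: filterS XM => z; rewrite normr_id.
Qed.

Lemma ae_bounded_max0 X : ae_bounded P X ->
  ae_bounded P (fun z => Num.max (X z) 0).
Proof.
move=> [mX [M XM]]; split; first exact: measurable_maxr.
exists M; apply: filterS XM => z Xz.
by rewrite ger0_norm ?le_max ?lexx ?orbT// ge_max (le_trans _ Xz) ?ler_norm//=
  (le_trans _ Xz).
Qed.

Lemma ae_bounded_sum (n : nat) (X : 'I_n -> sample R d -> R) :
  (forall i, ae_bounded P (X i)) ->
  ae_bounded P (fun z => \sum_(i < n) X i z).
Proof.
elim: n X => [|n IH] X bX.
  have -> : (fun z => \sum_(i < 0) X i z) = (fun=> 0).
    by apply/funext => z; rewrite big_ord0.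
  exact: ae_bounded_cst.
have -> : (fun z => \sum_(i < n.+1) X i z) =
    (fun z => \sum_(i < n) X (widen_ord (leqnSn n) i) z + X ord_max z).
  by apply/funext => z; rewrite big_ord_recr.
by apply: ae_boundedD; [apply: IH => i|]; exact: bX.
Qed.

Lemma ae_bounded_integrable X :
  ae_bounded P X -> P.-integrable [set: sample R d] (EFin \o X).
Proof. by move=> [mX [M XM]]; exact: integrable_ae_le XM. Qed.

Lemma Ex_def X : Ex P X = \int[P]_z X z.
Proof. by rewrite /Ex unlock. Qed.

Lemma Ex_cst c : Ex P (fun=> c) = c.
Proof. by rewrite /Ex expectation_cst. Qed.

Lemma ExD X Y : ae_bounded P X -> ae_bounded P Y ->
  Ex P (fun z => X z + Y z) = Ex P X + Ex P Y.
Proof.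
by move=> bX bY; rewrite !Ex_def RintegralD//; exact: ae_bounded_integrable.
Qed.

Lemma ExZ c X : ae_bounded P X -> Ex P (fun z => c * X z) = c * Ex P X.
Proof.
by move=> bX; rewrite !Ex_def RintegralZl//; exact: ae_bounded_integrable.
Qed.

Lemma ExB X Y : ae_bounded P X -> ae_bounded P Y ->
  Ex P (fun z => X z - Y z) = Ex P X - Ex P Y.
Proof.
by move=> bX bY; rewrite !Ex_def RintegralB//; exact: ae_bounded_integrable.
Qed.

Lemma Ex_sum (n : nat) (X : 'I_n -> sample R d -> R) :
  (forall i, ae_bounded P (X i)) ->
  Ex P (fun z => \sum_(i < n) X i z) = \sum_(i < n) Ex P (X i).
Proof.
elim: n X => [|n IH] X bX.
  rewrite big_ord0 -[RHS](Ex_cst 0); congr Ex.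
  by apply/funext => z; rewrite big_ord0.
rewrite big_ord_recr/= -IH// -ExD//; last exact: ae_bounded_sum.
by congr Ex; apply/funext => z; rewrite big_ord_recr.
Qed.

(** The variable is replaced by its positive part, which is nonnegative everywhere and almost
    everywhere equal to it. *)
Lemma Ex_ge0 X : ae_bounded P X -> {ae P, forall z, 0 <= X z} -> 0 <= Ex P X.
Proof.
move=> bX X0.
rewrite Ex_def.
have -> : \int[P]_z X z = \int[P]_z Num.max (X z) 0.
  congr fine; apply: ae_eq_integral => //.
  - by have [mX _] := bX; exact: measurableT_comp.
  - by have [mX _] := ae_bounded_max0 bX; exact: measurableT_comp.
  - by apply: filterS X0 => z Xz _; rewrite /= max_l.
by apply: Rintegral_ge0 => z _; rewrite le_max lexx orbT.
Qed.

Lemma le_Ex X Y : ae_bounded P X -> ae_bounded P Y ->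
  {ae P, forall z, X z <= Y z} -> Ex P X <= Ex P Y.
Proof.
move=> bX bY XY; rewrite -subr_ge0 -ExB//; apply: Ex_ge0.
  exact: ae_boundedB.
by apply: filterS XY => z; rewrite subr_ge0.
Qed.

End expectation.

(** * The surplus function and acceptance rules under one distribution *)

Section distribution.
Context {R : realType} {d : nat}.
Variables (P : probability (sample R d) R) (Rmax Amax : R).
Hypothesis P_ge0 : {ae P, forall z, forall j : 'I_d, 0 <= usage z j}.
Hypothesis P_le : {ae P, forall z, 0 <= reward z <= Rmax /\
                         forall j : 'I_d, `|usage z j| <= Amax}.
Implicit Types (p q : 'rV[R]_d) (x : sample R d -> R).

Lemma ae_bounded_reward : ae_bounded P reward.
Proof.
split; first exact: measurable_fst.
by exists Rmax; apply: filterS P_le => z [/andP[r0 rR] _]; rewrite ger0_norm.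
Qed.

Lemma ae_bounded_usage (j : 'I_d) : ae_bounded P (usage ^~ j).
Proof.
split; first exact: (measurableT_comp (measurable_tnth j) measurable_snd).
by exists Amax; apply: filterS P_le => z [_].
Qed.

Lemma ae_bounded_cost p : ae_bounded P (cost p).
Proof.
apply: ae_bounded_sum => j; apply: ae_boundedM; first exact: ae_bounded_cst.
exact: ae_bounded_usage.
Qed.

Lemma ae_bounded_margin p : ae_bounded P (fun z => reward z - cost p z).
Proof.
by apply: ae_boundedB; [exact: ae_bounded_reward | exact: ae_bounded_cost].
Qed.

Lemma ae_bounded_rule x : acceptance_rule x -> ae_bounded P x.
Proof.
move=> [mx x01]; split=> //; exists 1; apply: aeW => z.
by have /andP[x0 x1] := x01 z; rewrite ger0_norm.
Qed.

Lemma costB p q z :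
  cost q z - cost p z <= \sum_(j < d) `|p 0 j - q 0 j| * `|usage z j|.
Proof.
rewrite -sumrB; apply: ler_sum => j _.
by rewrite -mulrBl -normrM -normrN -mulNr opprB ler_norm.
Qed.

(** The positive part is 1-Lipschitz, and usages are almost surely at most [Amax]. *)
Lemma surplus_lipschitz p q :
  surplus P p - surplus P q <= Amax * \sum_(j < d) `|p 0 j - q 0 j|.
Proof.
rewrite lerBlDl -[X in _ <= _ + X](Ex_cst P) -ExD; last 2 first.
- exact/ae_bounded_max0/ae_bounded_margin.
- exact: ae_bounded_cst.
apply: le_Ex.
- exact/ae_bounded_max0/ae_bounded_margin.
- apply: ae_boundedD; last exact: ae_bounded_cst.
  exact/ae_bounded_max0/ae_bounded_margin.
apply: filterS P_le => z [_ zA].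
have c_le : cost q z - cost p z <= Amax * \sum_(j < d) `|p 0 j - q 0 j|.
  apply: le_trans (costB p q z) _; rewrite mulr_sumr; apply: ler_sum => j _.
  by rewrite mulrC ler_wpM2r.
have S0 : 0 <= Amax * \sum_(j < d) `|p 0 j - q 0 j|.
  rewrite mulr_sumr; apply: sumr_ge0 => j _; rewrite mulr_ge0//.
  exact: le_trans (zA j).
have m1 : reward z - cost q z <= Num.max (reward z - cost q z) 0.
  by rewrite le_max lexx.
have m2 : 0 <= Num.max (reward z - cost q z) 0 by rewrite le_max lexx orbT.
by rewrite ge_max; apply/andP; split; lra.
Qed.

(** For each sample the integrand is the positive part of an affine function of the price. *)
Lemma surplus_convex : is_convex_fun (surplus P).
Proof.
move=> p q t /andP[t0 t1]; rewrite /surplus -!ExZ; last 2 first.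
- exact/ae_bounded_max0/ae_bounded_margin.
- exact/ae_bounded_max0/ae_bounded_margin.
have bt s u : ae_bounded P (fun z => s * Num.max (reward z - cost u z) 0).
  apply: ae_boundedM; first exact: ae_bounded_cst.
  exact/ae_bounded_max0/ae_bounded_margin.
rewrite -ExD; [|exact: bt|exact: bt].
apply: le_Ex; first exact/ae_bounded_max0/ae_bounded_margin.
  by apply: ae_boundedD; exact: bt.
apply: aeW => z.
have -> : cost (t *: p + (1 - t) *: q) z = t * cost p z + (1 - t) * cost q z.
  rewrite /cost !mulr_sumr -big_split/=; apply: eq_bigr => j _.
  by rewrite !mxE; ring.
set u := reward z - cost p z; set v := reward z - cost q z.
have -> : reward z - (t * cost p z + (1 - t) * cost q z) = t * u + (1 - t) * v.
  by rewrite /u /v; ring.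
have s0 : 0 <= 1 - t by rewrite subr_ge0.
have u1 : u <= Num.max u 0 by rewrite le_max lexx.
have v1 : v <= Num.max v 0 by rewrite le_max lexx.
have u0 : 0 <= Num.max u 0 by rewrite le_max lexx orbT.
have v0 : 0 <= Num.max v 0 by rewrite le_max lexx orbT.
rewrite ge_max; apply/andP; split; last by rewrite addr_ge0// mulr_ge0.
by rewrite lerD// ler_wpM2l.
Qed.

(** Nonnegative prices and usages make the cost nonnegative, so the surplus is at most the reward.
    The bound serves as a Lipschitz constant in the weights. *)
Lemma surplus_bound p : (forall j, 0 <= p 0 j) -> `|surplus P p| <= Rmax.
Proof.
move=> p0; have bp := ae_bounded_max0 (ae_bounded_margin p).
rewrite ger0_norm; last first.
  by apply: Ex_ge0 => //; apply: aeW => z; rewrite le_max lexx orbT.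
rewrite -[leRHS](Ex_cst P); apply: le_Ex => //; first exact: ae_bounded_cst.
apply: filterS2 P_ge0 P_le => z u0 [/andP[r0 rR] _].
rewrite ge_max (le_trans r0 rR) andbT (le_trans _ rR)// gerBl.
by apply: sumr_ge0 => j _; rewrite mulr_ge0.
Qed.

Lemma ae_bounded_reward_rule x : acceptance_rule x ->
  ae_bounded P (fun z => reward z * x z).
Proof.
by move=> /ae_bounded_rule; exact/ae_boundedM/ae_bounded_reward.
Qed.

Lemma ae_bounded_usage_rule x (j : 'I_d) : acceptance_rule x ->
  ae_bounded P (fun z => usage z j * x z).
Proof.
by move=> /ae_bounded_rule; exact/ae_boundedM/ae_bounded_usage.
Qed.

Lemma Ex_margin_rule p x : acceptance_rule x ->
  Ex P (fun z => (reward z - cost p z) * x z) =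
  Ex P (fun z => reward z * x z) -
    \sum_(j < d) p 0 j * Ex P (fun z => usage z j * x z).
Proof.
move=> ax; have bu j := ae_bounded_usage_rule j ax.
have bpu j : ae_bounded P (fun z => p 0 j * (usage z j * x z)).
  by apply: ae_boundedM => //; exact: ae_bounded_cst.
under [in RHS]eq_bigr do rewrite -ExZ//.
rewrite -Ex_sum// -ExB; [|exact: ae_bounded_reward_rule|exact: ae_bounded_sum].
congr Ex; apply/funext => z; rewrite mulrBl; congr (_ - _).
by rewrite /cost mulr_suml; apply: eq_bigr => j _; rewrite mulrA.
Qed.

Lemma Ex_margin_rule_le p x : acceptance_rule x ->
  Ex P (fun z => (reward z - cost p z) * x z) <= surplus P p.
Proof.
move=> ax; apply: le_Ex.
- by apply: ae_boundedM; [exact: ae_bounded_margin|exact: ae_bounded_rule].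
- exact/ae_bounded_max0/ae_bounded_margin.
apply: aeW => z; have [_ /(_ z) /andP[x0 x1]] := ax.
rewrite le_max; have [m0|/ltW m0] := leP 0 (reward z - cost p z).
  by rewrite ler_piMr.
by rewrite mulr_le0_ge0// orbT.
Qed.

(** The rule with the largest expected margin at price [p]; accepting at zero margin changes nothing
    in that expectation. *)
Definition price_rule p (z : sample R d) : R :=
  if 0 <= reward z - cost p z then 1 else 0.

Lemma price_rule_accept p : acceptance_rule (price_rule p).
Proof.
split=> [|z]; last by rewrite /price_rule; case: ifP; rewrite lexx ler01.
apply: measurable_fun_ifT => //.
apply: measurable_fun_ler => //.
by have [] := ae_bounded_margin p.
Qed.

Lemma Ex_margin_price_rule p :
  Ex P (fun z => (reward z - cost p z) * price_rule p z) = surplus P p.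
Proof.
congr Ex; apply/funext => z; rewrite /price_rule.
have [m0|m0] := leP 0 (reward z - cost p z); first by rewrite mulr1.
by rewrite mulr0.
Qed.

(** This L^1 continuity is what carries rewards and usages to limits of rules. *)
Lemma Ex_rule_dist (X : sample R d -> R) (M : R) (x y : sample R d -> R) :
  ae_bounded P X -> {ae P, forall z, `|X z| <= M} ->
  acceptance_rule x -> acceptance_rule y ->
  Ex P (fun z => X z * x z) - Ex P (fun z => X z * y z) <=
  M * Ex P (fun z => `|x z - y z|).
Proof.
move=> bX XM ax ay.
have bx := ae_bounded_rule ax; have by_ := ae_bounded_rule ay.
have bd := ae_bounded_norm (ae_boundedB bx by_).
rewrite -ExB; [|exact: ae_boundedM|exact: ae_boundedM].
rewrite -ExZ//; apply: le_Ex.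
- by apply: ae_boundedB; exact: ae_boundedM.
- by apply: ae_boundedM => //; exact: ae_bounded_cst.
apply: filterS XM => z Xz; rewrite -mulrBr (le_trans (ler_norm _))//.
by rewrite normrM ler_wpM2r.
Qed.

End distribution.

(** * Limits of acceptance rules *)

Lemma limn_sup_between (R : realType) (u : R^nat) (a c : R) (k : nat) :
  bounded_fun u -> (forall m, (k <= m)%N -> a <= u m <= c) ->
  a <= limn_sup u <= c.
Proof.
move=> bu uk; rewrite limn_supE//.
have ub := bounded_fun_has_ubound bu.
apply/andP; split.
  apply: lb_le_inf; first by exists (sups u 0), 0%N.
  move=> _ [n _ <-].
  (* The index [maxn k n] lies in the tail from [n] and also where the bounds hold. *)
  have /andP[+ _] := uk (maxn k n) (leq_maxl _ _); move=> /le_trans; apply.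
  apply: ub_le_sup; first exact: has_ubound_sdrop.
  by exists (maxn k n) => //=; rewrite leq_maxr.
apply: (@le_trans _ _ (sups u k)).
  apply: ge_inf; last by exists k.
  exact: bounded_fun_has_lbound_sups.
apply: ge_sup; first by exists (u k), k => /=.
by move=> _ [n /= kn <-]; have /andP[] := uk n kn.
Qed.

Lemma telescope_dist (R : realType) (u : R^nat) (k n : nat) :
  `|u (k + n)%N - u k| <= \sum_(0 <= i < n) `|u (k + i)%N - u (k + i).+1|.
Proof.
elim: n => [|n IH]; first by rewrite addn0 subrr normr0 big_geq.
rewrite big_nat_recr//= addnS.
have -> : u (k + n).+1 - u k =
    (u (k + n)%N - u k) - (u (k + n)%N - u (k + n).+1).
  by ring.
by rewrite (le_trans (ler_normB _ _))// lerD.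
Qed.

(** The distance from the upper limit to [x k] is at most the sum of the later increments, which is
    integrated term by term. The upper limit is measurable and stays between 0 and 1 everywhere, so
    no null set has to be removed. *)
Lemma rule_limit (R : realType) (d : nat) (P : probability (sample R d) R)
    (x : nat -> sample R d -> R) :
  (forall k, acceptance_rule (x k)) ->
  (forall k, Ex P (fun z => `|x k z - x k.+1 z|) <= (2 ^ k)%:R^-1) ->
  acceptance_rule (fun z => limn_sup (x ^~ z)) /\
  forall k, Ex P (fun z => `|limn_sup (x ^~ z) - x k z|) <= 2 / (2 ^ k)%:R.
Proof.
move=> ax dx.
have x01 k z : 0 <= x k z <= 1 by have [] := ax k.
have bx z : bounded_fun (x ^~ z).
  exists 1; split; first exact: num_real.
  move=> M M1 k _ /=; have /andP[x0 x1] := x01 k z.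
  by rewrite ger0_norm// (le_trans x1)// ltW.
have ay : acceptance_rule (fun z => limn_sup (x ^~ z)).
  split.
    apply: measurable_fun_limn_sup => [z _|z _|k]; last by have [] := ax k.
      exact: bounded_fun_has_ubound.
    exact: bounded_fun_has_lbound.
  by move=> z; apply: (@limn_sup_between _ _ _ _ 0%N).
split=> // k.
have be n : ae_bounded P (fun z => `|x n z - x n.+1 z|).
  by apply/ae_bounded_norm/ae_boundedB; exact: ae_bounded_rule.
have bd : ae_bounded P (fun z => `|limn_sup (x ^~ z) - x k z|).
  by apply/ae_bounded_norm/ae_boundedB; exact: ae_bounded_rule.
have EE Y : ae_bounded P Y -> (Ex P Y)%:E = (\int[P]_z (Y z)%:E)%E.
  move=> bY; rewrite Ex_def /Rintegral fineK//.
  by apply: integrable_fin_num => //; exact: ae_bounded_integrable.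
rewrite -lee_fin EE//.
(* The series may diverge at some [z]; there the pointwise bound is trivial. *)
pose s z : \bar R :=
  (\sum_(0 <= n <oo) (`|x (k + n)%N z - x (k + n).+1 z|)%:E)%E.
have s_ge0 n z : (0 <= (`|x (k + n)%N z - x (k + n).+1 z|)%:E)%E.
  by rewrite lee_fin.
apply: (@le_trans _ _ (\int[P]_z s z)%E).
  apply: ge0_le_integral => //.
  - by have [mY _] := bd; exact: measurableT_comp.
  - apply: (@ge0_emeasurable_sum _ _ _ _
      (fun n z => (`|x (k + n)%N z - x (k + n).+1 z|)%:E) xpredT) => // n _.
    by have [mY _] := be (k + n)%N; exact: measurableT_comp.
  - move=> z _; have : (0 <= s z)%E by apply: nneseries_ge0.
    case E : (s z) => [S| |] // _; last by rewrite leey.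
    rewrite lee_fin.
    have xS m : (k <= m)%N -> `|x m z - x k z| <= S.
      move=> km; rewrite -(subnKC km).
      apply: le_trans (telescope_dist (x ^~ z) k _) _.
      rewrite -lee_fin -E -sumEFin; exact: nneseries_lim_ge.
    have /andP[l1 l2] : x k z - S <= limn_sup (x ^~ z) <= x k z + S.
      apply: (@limn_sup_between _ _ _ _ k) => // m /xS.
      by rewrite ler_norml => /andP[h1 h2]; apply/andP; split; lra.
    by rewrite ler_norml; apply/andP; split; lra.
rewrite integral_nneseries//; last first.
  by move=> n; have [mY _] := be (k + n)%N; exact: measurableT_comp.
have e0 : 0 <= 2 / (2 ^ k)%:R :> R by rewrite divr_ge0.
(* With total [2 / 2 ^ k], the term of index [n] of the comparison series is exactly the inverse of
   [2 ^ (k + n)]. *)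
apply: le_trans (epsilon_trick0 xpredT e0).
apply: lee_nneseries => [n _ _|n _]; first by apply: integral_ge0 => z _.
rewrite -EE// lee_fin (le_trans (dx _))// expnD expnS !natrM.
rewrite le_eqVlt; apply/orP; left; apply/eqP.
by field; rewrite !natrX ?expf_neq0.
Qed.

(** * Energy of families of rules and limits along nested sets *)

Section rule_families.
Context {R : realType} {d K : nat}.
Variable D : 'I_K -> probability (sample R d) R.
Implicit Types (x y : 'I_K -> sample R d -> R) (w : 'rV[R]_K).

Definition rules : set ('I_K -> sample R d -> R) :=
  [set x | forall t, acceptance_rule (x t)].

Definition mix_rules (s : R) x y : 'I_K -> sample R d -> R :=
  fun t z => s * x t z + (1 - s) * y t z.

Lemma mix_rules_accept s x y :
  0 <= s <= 1 -> rules x -> rules y -> rules (mix_rules s x y).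
Proof.
move=> /andP[s0 s1] ax ay t; have [mx x01] := ax t; have [my y01] := ay t.
split=> [|z]; first by apply: measurable_funD; apply: measurable_funM.
have /andP[x0 x1] := x01 z; have /andP[y0 y1] := y01 z.
by rewrite /mix_rules; apply/andP; split; nra.
Qed.

Lemma scale_rules_accept s x :
  0 <= s <= 1 -> rules x -> rules (fun t z => s * x t z).
Proof.
move=> /andP[s0 s1] ax t; have [mx x01] := ax t.
split=> [|z]; first exact: measurable_funM.
by have /andP[x0 x1] := x01 z; apply/andP; split; nra.
Qed.

(** The squared norm in the direct sum of the spaces L^2([D t]). It carries no mixture weights, so
    it controls every [x t], even one of weight 0. *)
Definition energy x : R := \sum_(t < K) Ex (D t) (fun z => x t z * x t z).

Lemma ae_bounded_sqr x t : rules x -> ae_bounded (D t) (fun z => x t z * x t z).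
Proof. by move=> /(_ t)/ae_bounded_rule bx; exact: ae_boundedM. Qed.

Lemma energy_ge0 x : rules x -> 0 <= energy x.
Proof.
move=> ax; apply: sumr_ge0 => t _; apply: Ex_ge0; first exact: ae_bounded_sqr.
by apply: aeW => z; rewrite -expr2 sqr_ge0.
Qed.

Lemma energy_le x : rules x -> energy x <= K%:R.
Proof.
move=> ax; rewrite -[K in leRHS]card_ord -sumr_const; apply: ler_sum => t _.
rewrite -[leRHS](Ex_cst (D t)); apply: le_Ex; first exact: ae_bounded_sqr.
  exact: ae_bounded_cst.
apply: aeW => z; have [_ /(_ z) /andP[x0 x1]] := ax t.
by rewrite mulr_ile1.
Qed.

Lemma energy_parallelogram x y : rules x -> rules y ->
  \sum_(t < K) Ex (D t) (fun z => (x t z - y t z) * (x t z - y t z)) =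
  2 * (energy x + energy y) - 4 * energy (mix_rules 2^-1 x y).
Proof.
move=> ax ay.
have am : rules (mix_rules 2^-1 x y) by apply: mix_rules_accept => //; lra.
rewrite /energy -big_split/= !mulr_sumr -sumrB; apply: eq_bigr => t _.
have bx := @ae_bounded_sqr x t ax; have by_ := @ae_bounded_sqr y t ay.
have bm := @ae_bounded_sqr _ t am.
have bZ c (X : sample R d -> R) : ae_bounded (D t) X ->
    ae_bounded (D t) (fun z => c * X z).
  by move=> bX; apply: ae_boundedM => //; exact: ae_bounded_cst.
have bxy : ae_bounded (D t) (fun z => x t z * x t z + y t z * y t z).
  exact: ae_boundedD.
rewrite -ExD// -!ExZ// -ExB; [|exact: bZ|exact: bZ].
by congr Ex; apply/funext => z; rewrite /mix_rules; field.
Qed.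

(** The pointwise inequality between [|u|] and [q / 2 * u^2 + 1 / (2 * q)], a completed square,
    takes the place of the Cauchy-Schwarz inequality. *)
Lemma Ex_norm_le (P : probability (sample R d) R) (u : sample R d -> R)
    (q : R) :
  0 < q -> ae_bounded P u -> Ex P (fun z => u z * u z) <= (q * q)^-1 ->
  Ex P (fun z => `|u z|) <= q^-1.
Proof.
move=> q0 bu uq.
have b1 : ae_bounded P (fun z => q / 2 * (u z * u z)).
  by apply: ae_boundedM; [exact: ae_bounded_cst | exact: ae_boundedM].
have b2 : ae_bounded P (fun=> q^-1 / 2) := ae_bounded_cst P _.
apply: (@le_trans _ _ (Ex P (fun z => q / 2 * (u z * u z) + q^-1 / 2))).
  apply: le_Ex; [exact: ae_bounded_norm | exact: ae_boundedD |].
  apply: aeW => z.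
  have -> : u z * u z = `|u z| * `|u z|.
    by rewrite -normrM ger0_norm// -expr2 sqr_ge0.
  have -> : q / 2 * (`|u z| * `|u z|) + q^-1 / 2 =
      `|u z| + q / 2 * ((`|u z| - q^-1) * (`|u z| - q^-1)).
    by field; rewrite gt_eqF.
  by rewrite lerDl mulr_ge0 ?divr_ge0 ?(ltW q0)// -expr2 sqr_ge0.
rewrite ExD// Ex_cst ExZ; last exact: ae_boundedM.
have q20 : 0 <= q / 2 by rewrite divr_ge0// ltW.
have := ler_wpM2l q20 uq.
have -> : q / 2 * (q * q)^-1 = q^-1 / 2 by field; rewrite gt_eqF.
lra.
Qed.

(* Almost minimal energy in the [n]-th set forces, by the parallelogram law, a
   Cauchy sequence in L^2: this replaces weak compactness of the rules. *)
Lemma nested_rules_limit (F : nat -> set ('I_K -> sample R d -> R)) :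
  (forall n, F n `<=` rules) ->
  (forall m n, (m <= n)%N -> F n `<=` F m) ->
  (forall n, F n !=set0) ->
  (forall n x y, F n x -> F n y -> F n (mix_rules 2^-1 x y)) ->
  exists2 y, rules y &
    forall e n, 0 < e ->
      exists2 x, F n x & forall t, Ex (D t) (fun z => `|y t z - x t z|) <= e.
Proof.
move=> Fr Fmono F0 Fmid.
(* These infima increase with [n] and are at most [K], so they approach their supremum [s]. *)
pose c n := inf [set energy x | x in F n].
have c_lb n : has_lbound [set energy x | x in F n].
  by exists 0 => _ [x Fx <-]; apply: energy_ge0; exact: Fr Fx.
have c_le n x : F n x -> c n <= energy x.
  by move=> Fx; apply: ge_inf => //; exists x.
have c_inf n e : 0 < e -> exists2 x, F n x & energy x < c n + e.
  move=> e0.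
  have [|_ [x Fx <-] xe] := @inf_adherent R [set energy x | x in F n] e e0.
    by split=> //; have [x Fx] := F0 n; exists (energy x), x.
  by exists x.
have c_mono m n : (m <= n)%N -> c m <= c n.
  move=> mn; apply: lb_le_inf.
    by have [x Fx] := F0 n; exists (energy x), x.
  by move=> _ [x Fx <-]; apply: c_le; exact: Fmono Fx.
have c_ub : has_ubound (range c).
  exists K%:R => _ [n _ <-]; have [x Fx] := F0 n.
  by apply: le_trans (c_le n x Fx) _; apply: energy_le; exact: Fr Fx.
pose s := sup (range c).
have c_s n : c n <= s by apply: ub_le_sup => //; exists n.
have c_sup e : 0 < e -> exists n, s - e < c n.
  move=> e0; have [|_ [n _ <-] ne] := @sup_adherent R (range c) e e0.
    by split=> //; exists (c 0%N), 0%N.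
  by exists n.
pose q k : R := (2 ^ k)%:R.
have q0 k : 0 < q k by rewrite ltr0n expn_gt0.
(* If two energies are below [s + e k] and that of the midpoint is above [s - e k], the
   parallelogram law bounds the squared distance by [8 * e k]. *)
pose e k : R := (q k * q k)^-1 / 8.
have e0 k : 0 < e k by rewrite divr_gt0// invr_gt0 mulr_gt0.
have eS k : e k.+1 <= e k.
  rewrite ler_pM2r// lef_pV2 ?posrE ?mulr_gt0// ler_pM ?(ltW (q0 _))//.
    by rewrite ler_nat leq_exp2l.
  by rewrite ler_nat leq_exp2l.
have step k : exists nx : nat * ('I_K -> sample R d -> R),
    [/\ (k <= nx.1)%N, s - e k < c nx.1, F nx.1 nx.2 & energy nx.2 < s + e k].
  have [n0 n0P] := c_sup _ (e0 k).
  have [x Fx xe] := c_inf (maxn k n0) _ (e0 k).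
  exists (maxn k n0, x); split=> //=; first exact: leq_maxl.
    by apply: lt_le_trans n0P _; apply: c_mono; exact: leq_maxr.
  by apply: lt_le_trans xe _; rewrite lerD2r.
have [nx nxP] := choice step.
pose xs k := (nx k).2.
have xs_rules k : rules (xs k) by have [_ _ /Fr] := nxP k.
have xs_dist k t : Ex (D t) (fun z => `|xs k t z - xs k.+1 t z|) <= (q k)^-1.
  have [_ nk Fk Ek] := nxP k; have [_ nk' Fk' Ek'] := nxP k.+1.
  have bxs m t' : ae_bounded (D t') (xs m t').
    by apply: ae_bounded_rule; exact: xs_rules.
  apply: Ex_norm_le => //; first exact: ae_boundedB.
  (* Both consecutive families lie in the larger set [F m], hence so does their midpoint, whose
     energy is at least [c m]. *)
  pose m := minn (nx k).1 (nx k.+1).1.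
  have cm : s - e k < c m.
    rewrite /m; case: (leqP (nx k).1 (nx k.+1).1) => _ //.
    by apply: le_lt_trans nk'; rewrite lerD2l lerN2.
  have Fm : F m (mix_rules 2^-1 (xs k) (xs k.+1)).
    by apply: Fmid; [apply: Fmono Fk; exact: geq_minl|
                     apply: Fmono Fk'; exact: geq_minr].
  have Em := lt_le_trans cm (c_le _ _ Fm).
  have bsq t' : ae_bounded (D t')
      (fun z => (xs k t' z - xs k.+1 t' z) * (xs k t' z - xs k.+1 t' z)).
    by apply: ae_boundedM; exact: ae_boundedB.
  have -> : (q k * q k)^-1 = 8 * e k by rewrite /e; field; rewrite gt_eqF.
  apply: (@le_trans _ _ (\sum_(t' < K) Ex (D t')
      (fun z => (xs k t' z - xs k.+1 t' z) * (xs k t' z - xs k.+1 t' z)))).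
    rewrite [leRHS](bigD1 t)//= lerDl; apply: sumr_ge0 => t' _.
    by apply: Ex_ge0 => //; apply: aeW => z; rewrite -expr2 sqr_ge0.
  rewrite energy_parallelogram//; move: Em Ek Ek' (eS k).
  rewrite -/(xs k) -/(xs k.+1).
  lra.
have lim t := rule_limit (fun k => xs_rules k t) (fun k => xs_dist k t).
exists (fun t z => limn_sup (fun k => xs k t z)).
  by move=> t; have [] := lim t.
(* The first argument places [xs k] in [F n]; the second, with [k < 2 ^ k], makes [2 / 2 ^ k] at
   most [a]. *)
move=> a n a0; pose k := maxn n (Num.bound (2 / a)).
exists (xs k).
  have [kn _ Fk _] := nxP k; apply: Fmono Fk.
  by apply: leq_trans kn; exact: leq_maxl.
move=> t; have [_ /(_ k)] := lim t; move=> /le_trans; apply.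
rewrite ler_pdivrMr ?q0// mulrC -ler_pdivrMr//.
apply: (@le_trans _ _ k%:R); last by rewrite ler_nat ltnW// ltn_expl.
apply: (@le_trans _ _ (Num.bound (2 / a))%:R); last by rewrite ler_nat leq_maxr.
by apply: ltW; rewrite archi_boundP// divr_ge0// ltW.
Qed.

End rule_families.

(** * Duality *)

Lemma eq_max_on (R : realType) (T : Type) (A : set T) (f g : T -> R) :
  (forall x, A x -> f x = g x) -> max_on A f = max_on A g.
Proof.
move=> fg; congr sup; apply/seteqP.
by split=> _ [x Ax <-]; exists x => //; rewrite fg.
Qed.

Lemma convex_price_box (R : realType) (n : nat) (M : R) :
  is_convex_set (price_box n M).
Proof.
move=> p q s p0M q0M /andP[s0 s1] j.
have /andP[p0 pM] := p0M j; have /andP[q0 qM] := q0M j.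
by rewrite !mxE; apply/andP; split; nra.
Qed.

Lemma price_box0 (R : realType) (n : nat) (M : R) :
  0 <= M -> price_box n M 0.
Proof. by move=> M0 j; rewrite mxE lexx. Qed.

Lemma dot_comb (R : realType) (n : nat) (p q c : 'rV[R]_n) (s u : R) :
  dot (s *: p + u *: q) c = s * dot p c + u * dot q c.
Proof.
rewrite /dot !mulr_sumr -big_split/=; apply: eq_bigr => j _.
by rewrite !mxE; ring.
Qed.

Lemma dotBr (R : realType) (n : nat) (p b c : 'rV[R]_n) :
  dot p (b - c) = dot p b - dot p c.
Proof. by rewrite -sumrB; apply: eq_bigr => j _; rewrite !mxE mulrBr. Qed.

Lemma simplex_mix (R : realType) (n : nat) (v w : 'rV[R]_n) (s : R) :
  0 <= s <= 1 -> simplex _ v -> simplex _ w ->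
  simplex _ (s *: v + (1 - s) *: w).
Proof.
move=> /andP[s0 s1] [v0 v1] [w0 w1]; split=> [t|].
  by rewrite !mxE addr_ge0// mulr_ge0// subr_ge0.
under eq_bigr do rewrite !mxE.
by rewrite big_split/= -!mulr_sumr v1 w1; ring.
Qed.

Lemma sum_delta (R : realType) (n : nat) (t : 'I_n) (c : 'I_n -> R) :
  \sum_(i < n) (delta_mx 0 t : 'rV[R]_n) 0 i * c i = c t.
Proof.
rewrite (bigD1 t)//= big1 ?mxE ?eqxx ?mul1r ?addr0// => i /negbTE it.
by rewrite mxE it andbF mul0r.
Qed.

Section duality.
Context {R : realType} {d K : nat}.
Variables (d_ge1 : (1 <= d)%N) (K_ge1 : (1 <= K)%N).
Variables (D : 'I_K -> probability (sample R d) R).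
Hypothesis D_ge0 : forall t : 'I_K,
  {ae D t, forall z, forall j : 'I_d, 0 <= usage z j}.
Variables (Rmax Amax : R).
Hypotheses (Rmax_gt0 : 0 < Rmax) (Amax_gt0 : 0 < Amax).
Hypothesis D_le : forall t : 'I_K,
  {ae D t, forall z, 0 <= reward z <= Rmax /\
                     forall j : 'I_d, `|usage z j| <= Amax}.
Variable b : 'rV[R]_d.
Hypothesis bmin_gt0 : 0 < bmin b.
Implicit Types (x y : 'I_K -> sample R d -> R) (w : 'rV[R]_K) (p : 'rV[R]_d).

Let box := price_box d (2 * Rmax / bmin b).

Lemma box_compact : compact box.
Proof. exact: price_box_compact. Qed.

Lemma box_nonempty : box !=set0.
Proof. by exists 0; apply: price_box0; rewrite divr_ge0 ?mulr_ge0// ltW. Qed.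

Lemma bmin_le j : bmin b <= b 0 j.
Proof. by apply: attains_min_ge => //; exact: attains_min_ord. Qed.

Lemma budget_gt0 j : 0 < b 0 j.
Proof. exact: lt_le_trans bmin_gt0 (bmin_le j). Qed.

(** * Regularity of the dual functions and exchange of the simplex with the box *)

Lemma mixed_dual_lipschitz w p q :
  mixed_dual D b w p - mixed_dual D b w q <=
  (\sum_(j < d) `|b 0 j| + Amax * \sum_(t < K) `|w 0 t|) *
    \sum_(j < d) `|p 0 j - q 0 j|.
Proof.
rewrite mulrDl /mixed_dual opprD addrACA lerD//.
  exact: dot_lipschitz.
rewrite -sumrB mulrAC mulr_sumr; apply: ler_sum => t _.
rewrite -mulrBr (le_trans (ler_norm _))// normrM mulrC ler_wpM2r//.
rewrite ler_norml (surplus_lipschitz (D_le t)) andbT lerNl opprB.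
rewrite (le_trans (surplus_lipschitz (D_le t) q p))//.
by under eq_bigr do rewrite distrC.
Qed.

Lemma mixed_dual_continuous w : continuous (mixed_dual D b w).
Proof. exact: lipschitz_coord_continuous (mixed_dual_lipschitz w). Qed.

Lemma mixed_dual_convex w : (forall t, 0 <= w 0 t) ->
  is_convex_fun (mixed_dual D b w).
Proof.
move=> w0 p q s s01; rewrite /mixed_dual dot_comb.
have -> : s * (dot p b + \sum_(t < K) w 0 t * surplus (D t) p) +
   (1 - s) * (dot q b + \sum_(t < K) w 0 t * surplus (D t) q) =
   s * dot p b + (1 - s) * dot q b + \sum_(t < K) w 0 t *
     (s * surplus (D t) p + (1 - s) * surplus (D t) q).
  under [in RHS]eq_bigr do rewrite mulrDr !(mulrCA (w 0 _)).
  by rewrite big_split/= -!mulr_sumr; ring.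
rewrite lerD2l; apply: ler_sum => t _; rewrite ler_wpM2l//.
exact: (surplus_convex (D_le t)).
Qed.

Lemma mixed_dual_attains w : attains_min box (mixed_dual D b w).
Proof.
apply: compact_attains_min; [exact: box_nonempty|exact: box_compact|].
exact: mixed_dual_continuous.
Qed.

(** On the box all surpluses are bounded by [Rmax], so the functions of [w] have a common Lipschitz
    constant, which their minimum inherits: both sides are compared at a minimizing price for
    [w]. *)
Lemma min_mixed_dual_continuous :
  continuous (fun w => min_on box (mixed_dual D b w)).
Proof.
apply: (@lipschitz_coord_continuous _ _ _ Rmax) => v w.
have [p bp pmin] := mixed_dual_attains w.
rewrite (min_onE bp pmin).
apply: (@le_trans _ _ (mixed_dual D b v p - mixed_dual D b w p)).
  by rewrite lerD2r; apply: attains_min_ge => //; exact: mixed_dual_attains.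
rewrite /mixed_dual opprD addrACA subrr add0r.
pose c : 'rV[R]_K := \row_t surplus (D t) p.
have cE (u : 'rV[R]_K) :
    \sum_(t < K) u 0 t * surplus (D t) p = \sum_(t < K) u 0 t * c 0 t.
  by apply: eq_bigr => t _; rewrite mxE.
rewrite !cE; apply: sum_le_norm => t; rewrite mxE.
apply: (surplus_bound (D_ge0 t) (D_le t)) => j.
by have /andP[] := bp j.
Qed.

Lemma min_mixed_dual_attains :
  attains_max (@simplex R K) (fun w => min_on box (mixed_dual D b w)).
Proof.
apply: compact_attains_max; [exact: simplex_nonempty|exact: simplex_compact|].
exact: min_mixed_dual_continuous.
Qed.

Lemma max_surplus_attains p :
  attains_max [set: 'I_K] (fun t => surplus (D t) p).
Proof. exact: attains_max_ord. Qed.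

Lemma robust_dual_attains : attains_min box (robust_dual D b).
Proof.
apply: compact_attains_min; [exact: box_nonempty|exact: box_compact|].
apply: (@lipschitz_coord_continuous _ _ _
  (\sum_(j < d) `|b 0 j| + Amax)) => p q.
rewrite mulrDl /robust_dual opprD addrACA lerD//.
  exact: dot_lipschitz.
have [t _ tmax] := max_surplus_attains p.
rewrite (max_onE (A := [set: 'I_K]) I tmax).
apply: le_trans (surplus_lipschitz (D_le t) p q).
rewrite lerD2l lerN2.
exact: (attains_max_le (max_surplus_attains q)).
Qed.

Lemma mixed_dual_le_robust w p :
  simplex _ w -> mixed_dual D b w p <= robust_dual D b p.
Proof.
move=> [w0 w1]; rewrite lerD2l.
rewrite -[leRHS]mul1r -w1 mulr_suml; apply: ler_sum => t _.
by rewrite ler_wpM2l//; exact: (attains_max_le (max_surplus_attains p)).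
Qed.

(** One inequality holds because an average is at most the maximum. If the other failed, at each
    price the unit mass on the best type would exceed the left side; [minimax] would give one weight
    vector doing so at all prices, against the maximality of [w]. *)
Lemma max_min_robust :
  max_on (@simplex R K) (fun w => min_on box (mixed_dual D b w)) =
  min_on box (robust_dual D b).
Proof.
have [w sw wmax] := min_mixed_dual_attains; rewrite (max_onE sw wmax).
have [p bp pmin] := robust_dual_attains; rewrite (min_onE bp pmin).
apply/eqP; rewrite eq_le; apply/andP; split.
  apply: le_trans (mixed_dual_le_robust p sw).
  by apply: attains_min_ge => //; exact: mixed_dual_attains.
rewrite leNgt; apply/negP => lt_wp.
(* The subtype is needed because convexity in the price relies on nonnegative weights. *)
pose f (v : {v : 'rV[R]_K | simplex _ v}) := mixed_dual D b (sval v).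
have [|||q bq|v vP] := @minimax R d _ box f (exist _ w sw)
    (min_on box (mixed_dual D b w)) box_compact (@convex_price_box _ _ _).
- by move=> v; exact: mixed_dual_continuous.
- by move=> [v [v0 v1]]; exact: mixed_dual_convex.
- move=> [v1 sv1] [v2 sv2] s s01.
  exists (exist _ _ (simplex_mix s01 sv1 sv2)) => q; rewrite /f /= /mixed_dual.
  under [in leRHS]eq_bigr do rewrite !mxE mulrDl -!mulrA.
  rewrite big_split/= -!mulr_sumr.
  by rewrite le_eqVlt; apply/orP; left; apply/eqP; ring.
- have [t _ tmax] := max_surplus_attains q.
  exists (exist _ _ (simplex_delta R t)); rewrite /f /= /mixed_dual sum_delta.
  apply: lt_le_trans lt_wp _; apply: le_trans (pmin q bq) _.
  by rewrite /robust_dual (max_onE (A := [set: 'I_K]) I tmax).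
have [u bu umin] := mixed_dual_attains (sval v).
have := wmax _ (svalP v); rewrite (min_onE bu umin) leNgt.
by rewrite vP.
Qed.

(** * The Lagrangian at fixed weights and strong duality *)

(** The common form of reward and usage, so that linearity and L^1 estimates are proved once. *)
Definition aggregate w (X : sample R d -> R) x : R :=
  \sum_(t < K) w 0 t * Ex (D t) (fun z => X z * x t z).

Lemma mixed_rewardE w x : mixed_reward D w x = aggregate w reward x.
Proof. by []. Qed.

Definition total_usage w x : 'rV[R]_d :=
  \row_j aggregate w (usage ^~ j) x.

Definition lagrangian w x p : R :=
  aggregate w reward x + dot p (b - total_usage w x).

Lemma feasibleE w x :
  feasible D b w x <-> rules x /\ forall j, total_usage w x 0 j <= b 0 j.
Proof.
by split=> -[ax ux]; split=> // j; have := ux j; rewrite mxE.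
Qed.

Lemma aggregate_comb w X x y s u :
  (forall t, ae_bounded (D t) X) -> rules x -> rules y ->
  aggregate w X (fun t z => s * x t z + u * y t z) =
  s * aggregate w X x + u * aggregate w X y.
Proof.
move=> bX ax ay; rewrite !mulr_sumr -big_split/=; apply: eq_bigr => t _.
have bM v x' : rules x' -> ae_bounded (D t) (fun z => v * (X z * x' t z)).
  move=> ax'; apply: ae_boundedM; first exact: ae_bounded_cst.
  by apply: ae_boundedM => //; exact: ae_bounded_rule.
rewrite !(mulrCA _ (w 0 t)) -mulrDr; congr (_ * _).
rewrite -!ExZ; last 2 first.
- by apply: ae_boundedM => //; exact: ae_bounded_rule.
- by apply: ae_boundedM => //; exact: ae_bounded_rule.
rewrite -ExD; [|exact: bM|exact: bM].
by congr Ex; apply/funext => z; ring.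
Qed.

Lemma aggregate_scale w X x s :
  (forall t, ae_bounded (D t) X) -> rules x ->
  aggregate w X (fun t z => s * x t z) = s * aggregate w X x.
Proof.
move=> bX ax; rewrite -[RHS]addr0 -[X in _ = _ + X](mul0r (aggregate w X x)).
rewrite -aggregate_comb//; congr aggregate.
by apply/funext => t; apply/funext => z; ring.
Qed.

Lemma aggregate_dist w X x y (M e : R) :
  0 <= M -> simplex _ w -> (forall t, ae_bounded (D t) X) ->
  (forall t, {ae D t, forall z, `|X z| <= M}) -> rules x -> rules y ->
  (forall t, Ex (D t) (fun z => `|x t z - y t z|) <= e) ->
  aggregate w X x <= aggregate w X y + M * e.
Proof.
move=> M0 [w0 w1] bX XM ax ay xy.
rewrite -lerBlDl -[leRHS]mul1r -w1 mulr_suml -sumrB; apply: ler_sum => t _.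
rewrite -mulrBr ler_wpM2l//.
apply: le_trans (Ex_rule_dist (bX t) (XM t) (ax t) (ay t)) _.
by rewrite ler_wpM2l.
Qed.

Lemma reward_bounded t : ae_bounded (D t) reward.
Proof. exact: (ae_bounded_reward (D_le t)). Qed.

Lemma usage_bounded j t : ae_bounded (D t) (usage ^~ j).
Proof. exact: (ae_bounded_usage (D_le t)). Qed.

Lemma reward_le t : {ae D t, forall z, `|reward z| <= Rmax}.
Proof.
by apply: filterS (D_le t) => z [/andP[r0 rR] _]; rewrite ger0_norm.
Qed.

Lemma usage_le j t : {ae D t, forall z, `|usage z j| <= Amax}.
Proof. by apply: filterS (D_le t) => z [_]. Qed.

(** Every rule is at L^1 distance at most 1 from the zero rule, which earns nothing. *)
Lemma total_reward_le w x : simplex _ w -> rules x ->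
  aggregate w reward x <= Rmax.
Proof.
move=> sw ax; have r0 : rules (fun _ _ => 0 : R).
  by move=> t; split=> // z; rewrite lexx ler01.
have -> : Rmax = aggregate w reward (fun _ _ => 0) + Rmax * 1.
  rewrite mulr1 [aggregate _ _ _]big1 ?add0r// => t _.
  rewrite [X in Ex _ X](_ : _ = fun=> 0) ?Ex_cst ?mulr0//.
  by apply/funext => z; rewrite mulr0.
apply: aggregate_dist => //.
- exact: ltW.
- exact: reward_bounded.
- exact: reward_le.
- move=> t; rewrite -[leRHS](Ex_cst (D t)).
  have bx := ae_bounded_rule (D t) (ax t).
  apply: le_Ex; last 1 first.
  + apply: aeW => z; rewrite subr0; have [_ /(_ z) /andP[x0 x1]] := ax t.
    by rewrite ger0_norm.
  + by apply: ae_bounded_norm; apply: ae_boundedB => //; exact: ae_bounded_cst.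
  + exact: ae_bounded_cst.
Qed.

(** Exchanging the sums over resources and types separates the Lagrangian by type, so each [x t] can
    be optimized alone. *)
Lemma lagrangianE w x p : rules x ->
  lagrangian w x p = dot p b +
    \sum_(t < K) w 0 t * Ex (D t) (fun z => (reward z - cost p z) * x t z).
Proof.
move=> ax.
under eq_bigr do rewrite (Ex_margin_rule (D_le _) p (ax _)) mulrBr.
rewrite sumrB /lagrangian dotBr addrCA; congr (_ + (_ - _)).
rewrite /dot; under eq_bigr do rewrite mxE mulr_sumr.
rewrite exchange_big/=; apply: eq_bigr => t _.
by rewrite mulr_sumr; apply: eq_bigr => j _; rewrite mulrCA.
Qed.

Lemma lagrangian_le_dual w x p : simplex _ w -> rules x ->
  lagrangian w x p <= mixed_dual D b w p.
Proof.
move=> [w0 w1] ax; rewrite lagrangianE// lerD2l; apply: ler_sum => t _.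
by rewrite ler_wpM2l//; exact: (Ex_margin_rule_le (D_le t)).
Qed.

Lemma lagrangian_price_rule w p :
  @rules R d K (fun=> price_rule p) /\
  lagrangian w (fun=> price_rule p) p = mixed_dual D b w p.
Proof.
have ap : @rules R d K (fun=> price_rule p).
  by move=> t; exact: (price_rule_accept (D_le t)).
split=> //; rewrite lagrangianE//; congr (_ + _).
by apply: eq_bigr => t _; rewrite Ex_margin_price_rule.
Qed.

(** Weak duality: nonnegative prices times nonnegative slacks only add to the reward. *)
Lemma feasible_le_dual w x p :
  simplex _ w -> feasible D b w x -> box p ->
  mixed_reward D w x <= mixed_dual D b w p.
Proof.
move=> sw /feasibleE[ax ux] bp; apply: le_trans (lagrangian_le_dual p sw ax).
rewrite lerDl; apply: sumr_ge0 => j _; rewrite mulr_ge0//.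
  by have /andP[] := bp j.
by rewrite 2!mxE subr_ge0.
Qed.

(* Dividing a rule by its largest overuse ratio [m] makes it feasible and costs
   at most [Rmax * (m - 1)] of reward; the price [2 * Rmax / bmin] on the most
   overused resource charges at least that much. *)
Lemma feasible_of_lagrangian w x (c : R) :
  simplex _ w -> rules x -> (forall p, box p -> c < lagrangian w x p) ->
  exists2 y, feasible D b w y & c < mixed_reward D w y.
Proof.
move=> sw ax cx; pose u := total_usage w x.
have [j _ jmax] : attains_max [set: 'I_d] (fun j => u 0 j / b 0 j).
  exact: attains_max_ord.
(* If no resource is overused, [x] is feasible, and at price 0 its Lagrangian is its reward. *)
have [m1|m1] := leP (u 0 j / b 0 j) 1.
  exists x.
    apply/feasibleE; split=> // i; have := le_trans (jmax i I) m1.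
    by rewrite ler_pdivrMr ?budget_gt0// mul1r.
  have := cx 0; rewrite /lagrangian /dot big1 ?addr0; first last.
    by move=> i _; rewrite mxE mul0r.
  by apply; apply: price_box0; rewrite divr_ge0 ?mulr_ge0// ltW.
set m := u 0 j / b 0 j in m1 jmax.
have m0 : 0 < m by exact: lt_trans m1.
pose P := 2 * Rmax / bmin b.
have P0 : 0 < P by rewrite divr_gt0// mulr_gt0.
exists (fun t z => m^-1 * x t z).
  apply/feasibleE; split.
    by apply: scale_rules_accept => //; rewrite invr_ge0 ltW//= invf_le1// ltW.
  move=> i; rewrite mxE aggregate_scale//; last exact: usage_bounded.
  rewrite mulrC ler_pdivrMr// mulrC -ler_pdivrMr ?budget_gt0//.
  by have := jmax i I; rewrite mxE.
have -> : mixed_reward D w (fun t z => m^-1 * x t z) =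
    m^-1 * aggregate w reward x.
  by rewrite -aggregate_scale//; exact: reward_bounded.
have bj : box (P *: delta_mx 0 j).
  move=> i; rewrite !mxE eqxx/=; case: (i == j); rewrite ?mulr1 ?mulr0.
    by rewrite lexx ltW.
  by rewrite lexx ltW.
apply: lt_le_trans (cx _ bj) _; rewrite /lagrangian.
have -> : dot (P *: delta_mx 0 j) (b - total_usage w x) = P * (b 0 j - u 0 j).
  rewrite /dot (bigD1 j)//= big1 ?addr0; last first.
    by move=> i /negbTE ij; rewrite !mxE ij andbF mulr0 mul0r.
  by rewrite !mxE !eqxx mulr1.
have uE : u 0 j = m * b 0 j by rewrite divfK// gt_eqF// budget_gt0.
have PB : 2 * Rmax <= P * b 0 j.
  by rewrite /P mulrAC ler_pdivlMr// ler_wpM2l ?bmin_le// mulr_ge0// ltW.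
have rR := total_reward_le sw ax.
set r := aggregate w reward x in rR *.
have mV : m * m^-1 = 1 by rewrite divff// gt_eqF.
have mV0 : 0 < m^-1 by rewrite invr_gt0.
(* The reward lost by scaling is at most [Rmax * (1 - m^-1)], hence at most [Rmax * (m - 1)]; the
   charge on resource [j] is at least twice that last bound. *)
have h1 : r - m^-1 * r <= Rmax * (1 - m^-1).
  have : 0 <= 1 - m^-1 by rewrite subr_ge0 invf_le1// ltW.
  by nra.
have h2 : 1 - m^-1 <= m - 1.
  have : 0 <= (m - 1) * (m - 1) * m^-1.
    by rewrite mulr_ge0 ?(ltW mV0)// -expr2 sqr_ge0.
  have -> : (m - 1) * (m - 1) * m^-1 = m - 1 - (1 - m^-1).
    by field; rewrite gt_eqF.
  by rewrite subr_ge0.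
have h3 : P * (b 0 j - u 0 j) <= - (2 * Rmax * (m - 1)).
  by rewrite uE; nra.
have h4 := ler_wpM2l (ltW Rmax_gt0) h2.
have h5 : 0 <= Rmax * (m - 1).
  by rewrite mulr_ge0 ?(ltW Rmax_gt0)// subr_ge0 ltW.
lra.
Qed.

(** At each price the price rule attains the dual value. The Lagrangian is affine in the price and
    in the rules, so [minimax] gives one family above [c] on the whole box, which is then scaled to
    feasibility. *)
Lemma lagrangian_minimax w (c : R) :
  simplex _ w -> (forall p, box p -> c < mixed_dual D b w p) ->
  exists2 y, feasible D b w y & c < mixed_reward D w y.
Proof.
move=> sw cw.
pose f (x : {x : 'I_K -> sample R d -> R | rules x}) := lagrangian w (sval x).
have [a0 _] := lagrangian_price_rule w 0.
have [|||p bp|[x ax] xP] := @minimax R d _ box f (exist _ _ a0) c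
    box_compact (@convex_price_box _ _ _).
- move=> x; apply: (@lipschitz_coord_continuous _ _ _
      (\sum_(j < d) `|(b - total_usage w (sval x)) 0 j|)) => p q.
  rewrite /f /lagrangian opprD addrACA subrr add0r.
  exact: dot_lipschitz.
- by move=> x p q s s01; rewrite /f /lagrangian dot_comb; lra.
- move=> [x ax] [y ay] s s01.
  exists (exist _ _ (mix_rules_accept s01 ax ay)) => p; rewrite /f /=.
  rewrite /lagrangian aggregate_comb//; last exact: reward_bounded.
  have -> : total_usage w (mix_rules s x y) =
      s *: total_usage w x + (1 - s) *: total_usage w y.
    apply/rowP => j; rewrite !mxE aggregate_comb//; exact: usage_bounded.
  have -> : dot p (b - (s *: total_usage w x + (1 - s) *: total_usage w y)) =
      s * dot p (b - total_usage w x) + (1 - s) * dot p (b - total_usage w y).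
    rewrite /dot !mulr_sumr -big_split/=; apply: eq_bigr => j _.
    by rewrite !mxE; ring.
  lra.
- have [ap pE] := lagrangian_price_rule w p.
  by exists (exist _ _ ap); rewrite /f /= pE cw.
exact: feasible_of_lagrangian xP.
Qed.

Lemma strong_duality w : simplex _ w ->
  exists2 y, feasible D b w y &
    mixed_reward D w y = min_on box (mixed_dual D b w).
Proof.
move=> sw; have [p bp pmin] := mixed_dual_attains w.
rewrite (min_onE bp pmin); set v := mixed_dual D b w p.
(* These sets are nested, stable under midpoints, and nonempty because the level stays strictly
   below the dual value. *)
pose F n := [set x | feasible D b w x /\ v - n.+1%:R^-1 <= mixed_reward D w x].
have [||n|n x y [fx vx] [fy vy]|y ay yP] := @nested_rules_limit R d K D F.
- by move=> n x [[ax _] _].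
- move=> m n mn x [fx vx]; split=> //; apply: le_trans vx.
  by rewrite lerD2l lerN2 lef_pV2 ?posrE ?ltr0n// ler_nat.
- have [q bq|y fy vy] := @lagrangian_minimax w (v - n.+1%:R^-1) sw.
    apply: lt_le_trans (pmin q bq).
    by rewrite ltrBlDr ltrDl invr_gt0 ltr0n.
  by exists y; split=> //; exact: ltW.
- move/feasibleE : fx => [ax ux]; move/feasibleE : fy => [ay uy]; split.
    apply/feasibleE; split; first by apply: mix_rules_accept => //; lra.
    move=> j; rewrite mxE aggregate_comb//; last exact: usage_bounded.
    have := ux j; have := uy j; rewrite !mxE; lra.
  rewrite mixed_rewardE (aggregate_comb _ _ _ reward_bounded ax ay).
  by move: vx vy; rewrite !mixed_rewardE; move: (v - _) => c; lra.
have fy : feasible D b w y.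
  apply/feasibleE; split=> // j; apply/ler_addgt0Pr => e e0.
  (* Index 0 is enough, as every set of the sequence consists of feasible families. *)
  have [|x [/feasibleE[ax ux] _] xy] := yP (e / Amax) 0%N.
    exact: divr_gt0.
  have := ux j; rewrite !mxE => uj.
  have := aggregate_dist (ltW Amax_gt0) sw (usage_bounded j) (usage_le j)
    ay ax xy.
  rewrite mulrC divfK ?gt_eqF// => /le_trans; apply.
  by rewrite lerD2r.
exists y => //; apply/eqP; rewrite eq_le feasible_le_dual//=.
apply/ler_addgt0Pr => e e0.
have e20 : 0 < e / 2 by rewrite divr_gt0.
(* Half of [e] pays for the L^1 distance, the other half for the suboptimality of [x]. *)
have [|x [/feasibleE[ax ux] vx] xy] :=
  yP (e / 2 / Rmax) (Num.bound (e / 2)^-1); first by rewrite divr_gt0.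
have xy' t : Ex (D t) (fun z => `|x t z - y t z|) <= e / 2 / Rmax.
  by under eq_fun do rewrite distrC.
have := aggregate_dist (ltW Rmax_gt0) sw reward_bounded reward_le ax ay xy'.
rewrite mulrC divfK ?gt_eqF//.
have : (Num.bound (e / 2)^-1).+1%:R^-1 <= e / 2.
  rewrite -[leRHS]invrK lef_pV2 ?posrE ?invr_gt0 ?ltr0n//.
  apply: (@le_trans _ _ (Num.bound (e / 2)^-1)%:R); last by rewrite ler_nat.
  by apply: ltW; apply: archi_boundP; rewrite invr_ge0 ltW.
by move: vx; rewrite !mixed_rewardE; move: _.+1%:R^-1 => c; lra.
Qed.

End duality.

Theorem theorem5 (R : realType) (d K : nat) (d_ge1 : (1 <= d)%N)
    (K_ge1 : (1 <= K)%N)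
    (D : 'I_K -> probability (sample R d) R)
    (D_nonneg : forall t : 'I_K,
      {ae D t, forall z, 0 <= reward z /\ forall j : 'I_d, 0 <= usage z j})
    (Rmax Amax : R) (Rmax_gt0 : 0 < Rmax) (Amax_gt0 : 0 < Amax)
    (D_bounded : forall t : 'I_K,
      {ae D t, forall z, 0 <= reward z <= Rmax /\
                         forall j : 'I_d, `|usage z j| <= Amax})
    (b : 'rV[R]_d) (b_ge0 : forall j : 'I_d, 0 <= b 0 j)
    (bmin_gt0 : 0 < bmin b) :
  let box := price_box d (2 * Rmax / bmin b) in
  (* every max and min in the equalities is attained *)
  [/\ forall w, simplex K w -> attains_max (feasible D b w) (mixed_reward D w),
      attains_max (simplex K)
        (fun w => max_on (feasible D b w) (mixed_reward D w)),
      forall w, simplex K w -> attains_min box (mixed_dual D b w),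
      attains_max (simplex K) (fun w => min_on box (mixed_dual D b w)) &
      attains_min box (robust_dual D b)] /\
  Vmix D b = max_on (simplex K) (fun w => min_on box (mixed_dual D b w)) /\
  max_on (simplex K) (fun w => min_on box (mixed_dual D b w))
    = min_on box (robust_dual D b).
Proof.
move=> box.
have D_ge0 t : {ae D t, forall z, forall j : 'I_d, 0 <= usage z j}.
  by apply: filterS (D_nonneg t) => z [].
(* Weak duality at a minimizing price turns the family given by [strong_duality] into a
   maximizer. *)
have primal w : simplex K w ->
    exists2 y, feasible D b w y & mixed_reward D w y =
      min_on box (mixed_dual D b w) /\
      forall x, feasible D b w x -> mixed_reward D w x <= mixed_reward D w y.
  move=> sw; have [y fy yE] :=
    strong_duality d_ge1 Rmax_gt0 Amax_gt0 D_bounded bmin_gt0 sw.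
  exists y => //; split=> // x fx; rewrite yE.
  have [p bp pmin] := mixed_dual_attains Rmax_gt0 D_bounded bmin_gt0 w.
  by rewrite (min_onE bp pmin); exact: (feasible_le_dual D_bounded sw fx bp).
have value w : simplex K w ->
    max_on (feasible D b w) (mixed_reward D w) = min_on box (mixed_dual D b w).
  by move=> /primal[y fy [<- ymax]]; exact: max_onE.
have dual_max :
    attains_max (simplex K) (fun w => min_on box (mixed_dual D b w)).
  exact: (min_mixed_dual_attains K_ge1 D_ge0).
split; first split.
- by move=> w /primal[y fy [_ ymax]]; exists y.
(* The two inner values agree on the simplex, so a maximizer for the dual function also serves the
   primal one. *)
- have [w sw wmax] := dual_max; exists w => // v sv.
  by rewrite !value//; exact: wmax.
- by move=> w _; exact: mixed_dual_attains.
- exact: dual_max.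
- exact: robust_dual_attains.
split; first exact: eq_max_on.
exact: (max_min_robust K_ge1 D_ge0).
Qed.
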